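(* Up to isomorphism, all Möbius $n$-pairs ($n\ge 4$) with a special decomposition are the following: 1. $\mathfrak{M}_{(4,\mathrm{id})}$, with $3$ distinct special decompositions, associated with $X=\{1,2\},\{1,3\},\{1,4\}$; 2. $\mathfrak{M}_{(4,(13)(24))}$, with the (unique) special decomposition associated with $X=\{1,3\}$; 3. $\mathfrak{M}_{(4,(12)(3)(4))}$, with the (unique) special decomposition associated with $X=\{1,2\}$.
   Context: A configuration is a pair $\langle S,\mathcal L\rangle$ of a point set $S$ and a family $\mathcal L$ of subsets of $S$ (blocks); an isomorphism is a bijection of the point sets under which a set of points is a block iff its image is a block. Let $n\ge 3$, $I=\{1,\dots,n\}$, $\varphi\in S_n$ a permutation of $I$, and let $A=\{a_1,\dots,a_n\}$, $B=\{b_1,\dots,b_n\}$ be disjoint $n$-element sets. For $i\in I$ put $A_i=(A\setminus\{a_i\})\cup\{b_i\}$ and $B_i=(B\setminus\{b_i\})\cup\{a_{\varphi(i)}\}$, $\mathcal L_A=\{A_i:i\in I\}$, $\mathcal L_B=\{B_i:i\in I\}$. The Möbius $n$-pair $\mathcal M=\mathfrak{M}_{(n,\varphi)}$ is the configuration with point set $A\cup B$ and block set $\mathcal L_A\cup\mathcal L_B$. Its standard simplices are $S_A(\mathcal M)=\langle A,\mathcal L_A\rangle$ and $S_B(\mathcal M)=\langle B,\mathcal L_B\rangle$. A decomposition of $\mathcal M$ into two complementary, mutually inscribed simplices $S_1=\langle P_1,\mathcal K_1\rangle$, $S_2=\langle P_2,\mathcal K_2\rangle$ (an unordered pair) consists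 of a partition $P_1\sqcup P_2$ of the points into two $n$-sets and a partition $\mathcal K_1\sqcup\mathcal K_2$ of the blocks into two $n$-sets such that: for $t=1,2$ every point of $P_t$ lies on all but exactly one of the blocks in $\mathcal K_t$, and every block in $\mathcal K_t$ contains all but exactly one of the points of $P_t$; and for $s\ne t$ every point of $P_t$ lies on exactly one block of $\mathcal K_s$, and every block of $\mathcal K_t$ contains exactly one point of $P_s$. For $n\ge 4$, it is called a special decomposition if $S_t\neq S_A(\mathcal M)$ and $S_t\ne S_B(\mathcal M)$ for $t=1,2$. For $n=4$ and a $2$-subset $X\subset I$ with $\varphi(X)=X$, the special decomposition associated with $X$ has one simplex with points $a_i$ ($i\in X$), $b_j$ ($j\in I\setminus X$) and blocks $B_i$ ($i\in X$), $A_j$ ($j\in I\setminus X$), the other simplex consisting of the remaining points and blocks. (Thus $X$ and $I\setminus X$ give the same decomposition.) *)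

(* Defs.v *)
From mathcomp Require Import all_boot all_fingroup.

Set Implicit Arguments.
Unset Strict Implicit.
Unset Printing Implicit Defensive.

Record configuration := Configuration {
  point : finType;
  blocks : {set {set point}}
}.

Definition isomorphic (M N : configuration) : Prop :=
  exists2 f : point M -> point N,
    bijective f &
    forall X : {set point M}, (X \in blocks M) = (f @: X \in blocks N).

Section Moebius.
Variables (n : nat) (phi : 'S_n).

Definition mpoint : finType := ('I_n + 'I_n)%type.

Definition pa (i : 'I_n) : mpoint := inl i.
Definition pb (i : 'I_n) : mpoint := inr i.

Definition setA : {set mpoint} := [set pa i | i : 'I_n].
Definition setB : {set mpoint} := [set pb i | i : 'I_n].

Definition blockA (i : 'I_n) : {set mpoint} := pb i |: (setA :\ pa i).
Definition blockB (i : 'I_n) : {set mpoint} := pa (phi i) |: (setB :\ pb i).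

Definition blocksA : {set {set mpoint}} := [set blockA i | i : 'I_n].
Definition blocksB : {set {set mpoint}} := [set blockB i | i : 'I_n].

Definition moebius : configuration :=
  @Configuration mpoint (blocksA :|: blocksB).

End Moebius.

(* A simplex <P, K> is kept as a pair in the ambient point set: the blocks in K
   are not subsets of P, each of them has one further point outside P. *)
Definition simplex (T : finType) : finType := ({set T} * {set {set T}})%type.

Definition points_of (T : finType) (S : simplex T) : {set T} := S.1.
Definition blocks_of (T : finType) (S : simplex T) : {set {set T}} := S.2.

Definition simplicial (T : finType) (S : simplex T) : Prop :=
  (forall x, x \in points_of S -> #|[set k in blocks_of S | x \notin k]| = 1)
  /\ (forall k, k \in blocks_of S -> #|[set x in points_of S | x \notin k]| = 1).

Definition inscribed (T : finType) (S S' : simplex T) : Prop :=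
  (forall x, x \in points_of S -> #|[set k in blocks_of S' | x \in k]| = 1)
  /\ (forall k, k \in blocks_of S -> #|[set x in points_of S' | x \in k]| = 1).

Definition complementary (M : configuration) (n : nat)
    (S1 S2 : simplex (point M)) : Prop :=
  [/\ points_of S1 :|: points_of S2 = [set: point M],
      [disjoint points_of S1 & points_of S2],
      #|points_of S1| = n & #|points_of S2| = n]
  /\ [/\ blocks_of S1 :|: blocks_of S2 = blocks M,
         [disjoint blocks_of S1 & blocks_of S2],
         #|blocks_of S1| = n & #|blocks_of S2| = n].

(* Decompositions are unordered: the set consisting of the two simplices. *)
Definition decomposition (M : configuration) (n : nat)
    (D : {set simplex (point M)}) : Prop :=
  exists S1 S2 : simplex (point M),
    [/\ D = [set S1; S2],
        complementary n S1 S2,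
        simplicial S1 /\ simplicial S2 &
        inscribed S1 S2 /\ inscribed S2 S1].

Definition std_simplexA (n : nat) (phi : 'S_n) : simplex (point (moebius phi)) :=
  (setA n, blocksA n).
Definition std_simplexB (n : nat) (phi : 'S_n) : simplex (point (moebius phi)) :=
  (setB n, blocksB phi).

Definition special_decomposition (n : nat) (phi : 'S_n)
    (D : {set simplex (point (moebius phi))}) : Prop :=
  decomposition n D
  /\ forall S, S \in D -> S <> std_simplexA phi /\ S <> std_simplexB phi.

(* The two simplices associated with X; intended for 2-subsets X of 'I_4 such
   that phi(X) = X. *)
Definition assoc_simplex (phi : 'S_4) (X : {set 'I_4}) :
    simplex (point (moebius phi)) :=
  ([set pa i | i in X] :|: [set pb j | j in ~: X],
   [set blockB phi i | i in X] :|: [set blockA j | j in ~: X]).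

Definition rest_simplex (phi : 'S_4) (X : {set 'I_4}) :
    simplex (point (moebius phi)) :=
  (~: points_of (assoc_simplex phi X),
   blocks (moebius phi) :\: blocks_of (assoc_simplex phi X)).

Definition assoc_decomposition (phi : 'S_4) (X : {set 'I_4}) :
    {set simplex (point (moebius phi))} :=
  [set assoc_simplex phi X; rest_simplex phi X].

(* The label k in {1,..,4} is the element k - 1 of 'I_4. *)
Definition lab (k : nat) : 'I_4 := inord k.-1.

Definition phi_id : 'S_4 := 1%g.
Definition phi_13_24 : 'S_4 := (tperm (lab 1) (lab 3) * tperm (lab 2) (lab 4))%g.
Definition phi_12 : 'S_4 := tperm (lab 1) (lab 2).

(* Main.v *)
Require Import Defs.
From mathcomp Require Import all_boot all_fingroup.
From mathcomp Require Import zify.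

(* A simplex of a decomposition is given by index sets: its points are a_i
   (i in X) and b_j (j in Y), its blocks A_i (i in U) and B_j (j in V).
   Counting the points of one simplex on the blocks of the other shows that U
   nonempty forces |I \ X| <= 2 and that I \ U nonempty forces |X| <= 2.  So
   either the decomposition is the standard one, or n = 4 and |X| = 2, and then
   the same counts give Y = U = I \ X, V = X and phi(X) = X.  Hence the special
   decompositions are those associated with invariant 2-subsets, and a
   permutation with an invariant 2-subset is conjugate to one of the three
   listed.  A_i is disjoint from B_j iff i = j and phi fixes i, while two blocks
   of one family always meet, so the number of fixed points of phi is an
   isomorphism invariant: it separates the three pairs.  An isomorphism carries
   decompositions to decompositions, but need not preserve the standard one;
   if the image of a special decomposition is standard, then the image of the
   standard one is special. *)

Set Implicit Arguments.
Unset Strict Implicit.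
Unset Printing Implicit Defensive.

Lemma card_setD1 (T : finType) (A : {set T}) x : #|A :\ x| = #|A| - (x \in A).
Proof. by rewrite (cardsD1 x A) addKn. Qed.

Lemma imset_setT (aT rT : finType) (f : aT -> rT) :
  [set f i | i : aT] = [set f i | i in [set: aT]].
Proof. by apply/setP => x; apply/imsetP/imsetP => -[i _ ->]; exists i. Qed.

(** * Incidence of points and blocks in terms of index sets *)

Section Incidence.
Variables (n : nat) (phi : 'S_n).
Implicit Types (i j : 'I_n) (X Y U V : {set 'I_n}).

Definition ptset X Y : {set mpoint n} := [set pa i | i in X] :|: [set pb j | j in Y].
Definition blset U V : {set {set mpoint n}} :=
  [set blockA i | i in U] :|: [set blockB phi j | j in V].

Lemma pa_inj : injective (@pa n). Proof. by move=> i j []. Qed.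
Lemma pb_inj : injective (@pb n). Proof. by move=> i j []. Qed.

Lemma mem_ptset_pa X Y i : (pa i \in ptset X Y) = (i \in X).
Proof.
rewrite inE (mem_imset _ _ pa_inj); apply/orb_idr.
by case/imsetP.
Qed.

Lemma mem_ptset_pb X Y i : (pb i \in ptset X Y) = (i \in Y).
Proof.
rewrite inE (mem_imset _ _ pb_inj); apply/orb_idl.
by case/imsetP.
Qed.

Lemma eq_mpointset (P Q : {set mpoint n}) :
  (forall i, (pa i \in P) = (pa i \in Q)) ->
  (forall i, (pb i \in P) = (pb i \in Q)) -> P = Q.
Proof. by move=> ea eb; apply/setP => -[] i; [apply: ea | apply: eb]. Qed.

Lemma ptset_preim (P : {set mpoint n}) : P = ptset (@pa n @^-1: P) (@pb n @^-1: P).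
Proof.
by apply: eq_mpointset => i; rewrite ?mem_ptset_pa ?mem_ptset_pb inE.
Qed.

Lemma setA_ptset : setA n = ptset setT set0.
Proof. by rewrite /ptset imset0 setU0 -imset_setT. Qed.

Lemma setB_ptset : setB n = ptset set0 setT.
Proof. by rewrite /ptset imset0 set0U -imset_setT. Qed.

Lemma card_ptset X Y : #|ptset X Y| = #|X| + #|Y|.
Proof.
rewrite cardsU !card_imset; [|exact: pb_inj|exact: pa_inj].
rewrite (_ : _ :&: _ = set0) ?cards0 ?subn0 //.
by apply/setP => x; rewrite !inE; apply/andP => -[/imsetP[i _ ->] /imsetP[]].
Qed.

Lemma ptsetC X Y : ~: ptset X Y = ptset (~: X) (~: Y).
Proof.
by apply: eq_mpointset => i; rewrite inE ?mem_ptset_pa ?mem_ptset_pb inE.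
Qed.

Lemma pa_blockA i j : (pa i \in blockA j) = (i != j).
Proof.
by rewrite /blockA setA_ptset in_setU1 in_setD1 mem_ptset_pa !inE andbT.
Qed.

Lemma pb_blockA i j : (pb i \in blockA j) = (i == j).
Proof. by rewrite /blockA setA_ptset in_setU1 in_setD1 mem_ptset_pb !inE andbF orbF. Qed.

Lemma pb_blockB i j : (pb i \in blockB phi j) = (i != j).
Proof. by rewrite /blockB setB_ptset in_setU1 in_setD1 mem_ptset_pb !inE andbT. Qed.

Lemma pa_blockB i j : (pa i \in blockB phi j) = (i == phi j).
Proof. by rewrite /blockB setB_ptset in_setU1 in_setD1 mem_ptset_pa !inE andbF orbF. Qed.

Definition in_blockE := (pa_blockA, pb_blockA, pa_blockB, pb_blockB).

Lemma blockA_inj : injective (@blockA n).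
Proof. by move=> i j /setP /(_ (pb i)); rewrite !in_blockE eqxx => /esym /eqP. Qed.

Lemma blockB_inj : injective (blockB phi).
Proof.
by move=> i j /setP /(_ (pb i)); rewrite !in_blockE eqxx => /esym /negbFE /eqP.
Qed.

(** Counts of this shape turn each condition on a decomposition into a numerical condition on index
    sets. *)
Lemma card_ptset_blockA X Y i :
  #|[set x in ptset X Y | x \in blockA i]| = #|X :\ i| + (i \in Y).
Proof.
rewrite (_ : [set _ in _ | _] = ptset (X :\ i) (Y :&: [set i])).
  rewrite card_ptset; congr (_ + _); case: (boolP (i \in Y)) => iY.
    by rewrite (setIidPr _) ?sub1set // cards1.
  by rewrite (disjoint_setI0 _) ?cards0 // disjoint_sym disjoints1.
by apply: eq_mpointset => j;
   rewrite inE ?mem_ptset_pa ?mem_ptset_pb ?in_blockE !inE // andbC.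
Qed.

Lemma card_ptset_blockB X Y i :
  #|[set x in ptset X Y | x \in blockB phi i]| = #|Y :\ i| + (phi i \in X).
Proof.
rewrite (_ : [set _ in _ | _] = ptset (X :&: [set phi i]) (Y :\ i)).
  rewrite card_ptset addnC; congr (_ + _); case: (boolP (phi i \in X)) => iY.
    by rewrite (setIidPr _) ?sub1set // cards1.
  by rewrite (disjoint_setI0 _) ?cards0 // disjoint_sym disjoints1.
by apply: eq_mpointset => j;
   rewrite inE ?mem_ptset_pa ?mem_ptset_pb ?in_blockE !inE // andbC.
Qed.

Hypothesis n_gt2 : 2 < n.

Lemma exists_third i j : exists k : 'I_n, k \notin [set i; j].
Proof.
have [k] : exists k, k \in ~: [set i; j].
  by apply/set0Pn; rewrite -card_gt0 -(ltn_add2l #|[set i; j]|) cardsC cards2 card_ord; lia.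
by rewrite inE; exists k.
Qed.

(** A third index k separates the two: b_k lies on B_j but not on A_i. Hence the index sets of a set
    of blocks are well defined. *)
Lemma blockA_neq_blockB i j : blockA i <> blockB phi j.
Proof.
have [k] := exists_third i j.
rewrite !inE negb_or => /andP[ki kj] /setP /(_ (pb k)).
by rewrite !in_blockE kj (negPf ki).
Qed.

Lemma mem_blset_A U V i : (blockA i \in blset U V) = (i \in U).
Proof.
rewrite inE (mem_imset _ _ blockA_inj); apply/orb_idr.
by case/imsetP => j _ /blockA_neq_blockB.
Qed.

Lemma mem_blset_B U V i : (blockB phi i \in blset U V) = (i \in V).
Proof.
rewrite inE (mem_imset _ _ blockB_inj); apply/orb_idl.
by case/imsetP => j _ /esym /blockA_neq_blockB.
Qed.

Definition mem_blset := (mem_blset_A, mem_blset_B).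

Lemma blocks_blset : blocks (moebius phi) = blset setT setT.
Proof. by rewrite /blset -!imset_setT. Qed.

Lemma blset_elim (P : {set mpoint n} -> Prop) U V :
  (forall i, i \in U -> P (blockA i)) ->
  (forall i, i \in V -> P (blockB phi i)) ->
  forall k, k \in blset U V -> P k.
Proof. by move=> PA PB k /setUP[] /imsetP[i ? ->]; auto. Qed.

(** The inclusions are there because a general set of point sets may contain members that are not
    blocks, on which the two tests say nothing. *)
Lemma eq_blset_sub (K L : {set {set mpoint n}}) :
  K \subset blset setT setT -> L \subset blset setT setT ->
  (forall i, (blockA i \in K) = (blockA i \in L)) ->
  (forall i, (blockB phi i \in K) = (blockB phi i \in L)) -> K = L.
Proof.
move=> /subsetP sK /subsetP sL eA eB; apply/setP => k.
have [|kN] := boolP (k \in blset setT setT).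
  by move: k; apply: blset_elim => i _.
by rewrite (contraNF (sK k) kN) (contraNF (sL k) kN).
Qed.

Lemma blset_sub U V : blset U V \subset blset setT setT.
Proof. by apply/subsetP; apply: blset_elim => i _; rewrite mem_blset inE. Qed.

Lemma card_blset U V : #|blset U V| = #|U| + #|V|.
Proof.
rewrite cardsU !card_imset; [|exact: blockB_inj|exact: blockA_inj].
rewrite (_ : _ :&: _ = set0) ?cards0 ?subn0 //.
apply/setP => x; rewrite !inE; apply/andP => -[/imsetP[i _ ->] /imsetP[j _]].
exact: blockA_neq_blockB.
Qed.

Lemma blset_preim (K : {set {set mpoint n}}) :
  K \subset blset setT setT ->
  K = blset (@blockA n @^-1: K) (blockB phi @^-1: K).
Proof.
by move=> sK; apply: eq_blset_sub; rewrite ?blset_sub // => i;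
   rewrite mem_blset inE.
Qed.

Lemma blsetC U V : blset setT setT :\: blset U V = blset (~: U) (~: V).
Proof.
apply: eq_blset_sub; rewrite ?blset_sub ?subsetDl // => i;
by rewrite inE !mem_blset !inE andbT.
Qed.

(** The only B-block through a_i is the one with index phi^-1(i), whence the inverse permutation. *)
Lemma card_blset_pa U V i :
  #|[set k in blset U V | pa i \in k]| = #|U :\ i| + ((phi^-1)%g i \in V).
Proof.
rewrite (_ : [set _ in _ | _] = blset (U :\ i) (V :&: [set (phi^-1)%g i])).
  rewrite card_blset; congr (_ + _); case: (boolP (_ \in V)) => iV.
    by rewrite (setIidPr _) ?sub1set // cards1.
  by rewrite (disjoint_setI0 _) ?cards0 // disjoint_sym disjoints1.
apply: eq_blset_sub; rewrite ?blset_sub //.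
- by apply: subset_trans (blset_sub U V); apply/subsetP => k; rewrite inE => /andP[].
- by move=> j; rewrite in_set !mem_blset !in_blockE !inE andbC eq_sym.
- by move=> j; rewrite in_set !mem_blset !in_blockE !inE -(can2_eq (permK _) (permKV _)) eq_sym.
Qed.

Lemma card_blset_pb U V i :
  #|[set k in blset U V | pb i \in k]| = #|V :\ i| + (i \in U).
Proof.
rewrite (_ : [set _ in _ | _] = blset (U :&: [set i]) (V :\ i)).
  rewrite card_blset addnC; congr (_ + _); case: (boolP (_ \in U)) => iU.
    by rewrite (setIidPr _) ?sub1set // cards1.
  by rewrite (disjoint_setI0 _) ?cards0 // disjoint_sym disjoints1.
apply: eq_blset_sub; rewrite ?blset_sub //.
- by apply: subset_trans (blset_sub U V); apply/subsetP => k; rewrite inE => /andP[].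
- by move=> j; rewrite in_set !mem_blset !in_blockE !inE eq_sym.
- by move=> j; rewrite in_set !mem_blset !in_blockE !inE andbC eq_sym.
Qed.

(** The second simplex is the complement of the first in points and in blocks, so four index sets
    describe both. *)
Lemma complementaryP (S1 S2 : simplex (point (moebius phi))) :
  complementary n S1 S2 <->
  exists X Y U V, [/\ S1 = (ptset X Y, blset U V),
    S2 = (ptset (~: X) (~: Y), blset (~: U) (~: V)),
    #|X| + #|Y| = n & #|U| + #|V| = n].
Proof.
have UC (T : finType) (A B C : {set T}) : A :|: B = C -> [disjoint A & B] -> B = C :\: A.
  by move=> <- dAB; rewrite setDUl setDv set0U; apply/esym/setDidPl; rewrite disjoint_sym.
split.
  case: S1 S2 => [P1 K1] [P2 K2] /= [[UP dP cP _] [UK dK cK _]].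
  rewrite blocks_blset in UK.
  exists (@pa n @^-1: P1), (@pb n @^-1: P1), (@blockA n @^-1: K1), (blockB phi @^-1: K1).
  have eK1 := blset_preim (K := K1).
  have sK1 : K1 \subset blset setT setT by rewrite -UK subsetUl.
  rewrite -card_ptset -card_blset -eK1 // -ptset_preim; split=> //.
  rewrite -ptsetC -ptset_preim -blsetC -eK1 // -setTD.
  by congr (_, _); [apply: UC UP dP | apply: UC UK dK].
case=> X [Y [U [V [-> -> cXY cUV]]]].
rewrite /complementary /points_of /blocks_of [_.1]/= [_.2]/=; split.
  rewrite !card_ptset -ptsetC setUCr -setI_eq0 setICr eqxx; split=> //.
  have := cardsC X; have := cardsC Y; rewrite card_ord; lia.
rewrite !card_blset -blsetC blocks_blset; split=> //.
- by rewrite -{1}(setIidPr (blset_sub U V)) setID.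
- by rewrite -setI_eq0 setIDA setIC -setIDA setDv setI0.
- have := cardsC U; have := cardsC V; rewrite card_ord; lia.
Qed.

End Incidence.

(** * Decompositions as numerical conditions on four index sets *)

Section Simplices.
Variables (n : nat) (phi : 'S_n).
Hypothesis n_gt2 : 2 < n.
Implicit Types (i j : 'I_n) (X Y U V : {set 'I_n}).

Definition simplex_of X Y U V : simplex (mpoint n) := (ptset X Y, blset phi U V).

(** Trades a count of misses for a count of hits, which the incidence formulas compute; the additive
    form avoids truncated subtraction. *)
Lemma card_notin (T : finType) (A : {set T}) (p : pred T) :
  (#|[set x in A | ~~ p x]| = 1) <-> #|[set x in A | p x]| + 1 = #|A|.
Proof.
have := cardsID [set x | p x] A.
have -> : A :&: [set x | p x] = [set x in A | p x] by apply/setP => x; rewrite !inE.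
have -> : A :\: [set x | p x] = [set x in A | ~~ p x].
  by apply/setP => x; rewrite !inE andbC.
lia.
Qed.

Lemma forall_ptset (P : mpoint n -> Prop) X Y :
  (forall x, x \in ptset X Y -> P x) <->
  (forall i, i \in X -> P (pa i)) /\ (forall i, i \in Y -> P (pb i)).
Proof.
split=> [H|[HX HY] x /setUP[] /imsetP[i ? ->]]; auto.
by split=> i ?; apply: H; rewrite ?mem_ptset_pa ?mem_ptset_pb.
Qed.

Lemma forall_blset (P : {set mpoint n} -> Prop) U V :
  (forall k, k \in blset phi U V -> P k) <->
  (forall i, i \in U -> P (blockA i)) /\ (forall i, i \in V -> P (blockB phi i)).
Proof.
split=> [H|[HU HV] k /setUP[] /imsetP[i ? ->]]; auto.
by split=> i ?; apply: H; rewrite mem_blset.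
Qed.

Lemma simplicialP X Y U V :
  simplicial (simplex_of X Y U V) <->
  [/\ forall i, i \in X -> #|U :\ i| + ((phi^-1)%g i \in V) + 1 = #|U| + #|V|,
      forall i, i \in Y -> #|V :\ i| + (i \in U) + 1 = #|U| + #|V|,
      forall i, i \in U -> #|X :\ i| + (i \in Y) + 1 = #|X| + #|Y| &
      forall i, i \in V -> #|Y :\ i| + (phi i \in X) + 1 = #|X| + #|Y|].
Proof.
rewrite /simplicial /simplex_of /points_of /blocks_of /= forall_ptset forall_blset.
split=> [[[h1 h2] [h3 h4]]|[h1 h2 h3 h4]]; last split.
- split=> i /[dup] iX.
  + by move=> /h1 /card_notin; rewrite card_blset_pa // card_blset.
  + by move=> /h2 /card_notin; rewrite card_blset_pb // card_blset.
  + by move=> /h3 /card_notin; rewrite card_ptset_blockA card_ptset.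
  + by move=> /h4 /card_notin; rewrite card_ptset_blockB card_ptset.
- split=> i iX; apply/card_notin.
    by rewrite card_blset_pa // card_blset // h1.
  by rewrite card_blset_pb // card_blset // h2.
- split=> i iX; apply/(card_notin _ (fun x => x \in _)).
    by rewrite card_ptset_blockA card_ptset h3.
  by rewrite card_ptset_blockB card_ptset h4.
Qed.

Lemma inscribedP X Y U V X' Y' U' V' :
  inscribed (simplex_of X Y U V) (simplex_of X' Y' U' V') <->
  [/\ forall i, i \in X -> #|U' :\ i| + ((phi^-1)%g i \in V') = 1,
      forall i, i \in Y -> #|V' :\ i| + (i \in U') = 1,
      forall i, i \in U -> #|X' :\ i| + (i \in Y') = 1 &
      forall i, i \in V -> #|Y' :\ i| + (phi i \in X') = 1].
Proof.
rewrite /inscribed /simplex_of /points_of /blocks_of /= forall_ptset forall_blset.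
split=> [[[h1 h2] [h3 h4]]|[h1 h2 h3 h4]]; last split.
- split=> i ?.
  + by rewrite -card_blset_pa // h1.
  + by rewrite -(card_blset_pb phi) // h2.
  + by rewrite -card_ptset_blockA h3.
  + by rewrite -card_ptset_blockB h4.
- by split=> i ?; rewrite ?card_blset_pa ?card_blset_pb ?h1 ?h2.
- by split=> i ?; rewrite ?card_ptset_blockA ?card_ptset_blockB ?h3 ?h4.
Qed.

Lemma std_simplexA_of : std_simplexA phi = simplex_of setT set0 setT set0.
Proof. by rewrite /std_simplexA /simplex_of /blset setA_ptset imset0 setU0 -imset_setT. Qed.

Lemma std_simplexB_of : std_simplexB phi = simplex_of set0 setT set0 setT.
Proof. by rewrite /std_simplexB /simplex_of /blset setB_ptset imset0 set0U -imset_setT. Qed.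

Lemma decompositionE (D : {set simplex (point (moebius phi))}) :
  decomposition n D <->
  exists X Y U V,
    [/\ D = [set simplex_of X Y U V; simplex_of (~: X) (~: Y) (~: U) (~: V)],
        #|X| + #|Y| = n /\ #|U| + #|V| = n,
        simplicial (simplex_of X Y U V) /\
        simplicial (simplex_of (~: X) (~: Y) (~: U) (~: V)) &
        inscribed (simplex_of X Y U V) (simplex_of (~: X) (~: Y) (~: U) (~: V)) /\
        inscribed (simplex_of (~: X) (~: Y) (~: U) (~: V)) (simplex_of X Y U V)].
Proof.
split.
  case=> S1 [S2 [-> /(complementaryP n_gt2)[X [Y [U [V [-> -> cP cB]]]]] sS iS]].
  by exists X, Y, U, V; split.
case=> X [Y [U [V [-> [cP cB] sS iS]]]].
exists (simplex_of X Y U V), (simplex_of (~: X) (~: Y) (~: U) (~: V)); split=> //.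
by apply/(complementaryP n_gt2); exists X, Y, U, V.
Qed.

Lemma cardsT_D1 i : #|[set: 'I_n] :\ i| = n.-1.
Proof. by rewrite card_setD1 cardsT card_ord in_setT subn1. Qed.

(** Supplies the decomposition whose image becomes special when an isomorphism sends a special one
    to the standard one. *)
Lemma std_decomposition :
  decomposition n [set std_simplexA phi; std_simplexB phi].
Proof.
apply/decompositionE; exists setT, set0, setT, set0.
rewrite !setCT !setC0 -std_simplexA_of -std_simplexB_of.
rewrite std_simplexA_of std_simplexB_of cards0 cardsT card_ord addn0.
split=> //; split; apply/simplicialP || apply/inscribedP; split=> i;
  rewrite ?inE ?set0D ?cards0 ?cardsT_D1 ?card_ord ?cardsT ?card_ord ?inE //=; lia.
Qed.

Lemma inscribed_cases X Y U V :
  3 < n -> #|X| + #|Y| = n ->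
  inscribed (simplex_of X Y U V) (simplex_of (~: X) (~: Y) (~: U) (~: V)) ->
  inscribed (simplex_of (~: X) (~: Y) (~: U) (~: V)) (simplex_of X Y U V) ->
  [\/ X = setT /\ U = setT, X = set0 /\ U = set0 |
      [/\ n = 4 /\ #|X| = 2, Y = ~: X, U = ~: X, V = X &
          forall i, (phi i \in X) = (i \in X)]].
Proof.
move=> n_gt3 cXY /inscribedP[pX pY pU pV] /inscribedP[qX qY qU qV].
have cX : #|X| + #|~: X| = n by rewrite cardsC card_ord.
have cY : #|Y| + #|~: Y| = n by rewrite cardsC card_ord.
(* If the first simplex has no A-block, the second has them all, and a point a_i of the first would
   lie on n - 1 > 1 of them. *)
have [U0|/set0Pn[i0 i0U]] := eqVneq U set0.
  constructor 2; split=> //; apply/setP => i; rewrite inE.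
  apply/negP => /pX; rewrite U0 setC0 cardsT_D1; lia.
have [UT|/set0Pn[i1 i1U]] := eqVneq (~: U) set0.
  rewrite -[U]setCK UT setC0 in qX *.
  constructor 1; split=> //; apply/setP => i; rewrite [RHS]inE.
  apply/negbNE/negP => iX; have := qX i; rewrite inE iX cardsT_D1 => /(_ isT); lia.
constructor 3.
have eU i : i \in U -> #|~: X :\ i| + (i \notin Y) = 1 by move/pU; rewrite inE.
have dX i : #|X| = (i \in X) + #|X :\ i| by apply: cardsD1.
have dY i : #|Y| = (i \in Y) + #|Y :\ i| by apply: cardsD1.
have eX i : #|~: X| = (i \notin X) + #|~: X :\ i| by rewrite -in_setC; apply: cardsD1.
have eY i : #|~: Y| = (i \notin Y) + #|~: Y :\ i| by rewrite -in_setC; apply: cardsD1.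
have [n4 [X2 XC2]] : n = 4 /\ #|X| = 2 /\ #|~: X| = 2.
  have := eU _ i0U; have := eX i0.
  have := qU _ i1U; have := dX i1.
  lia.
have [Y2 YC2] : #|Y| = 2 /\ #|~: Y| = 2 by lia.
(* With |X| = |I \ X| = 2, the count at A_i can equal 1 only if removing i shrinks the 2-set and the
   other summand vanishes. This fixes both memberships. *)
have hU i : (i \in U) = (i \notin X) /\ (i \in Y) = (i \notin X).
  case: (boolP (i \in U)) => iU.
    have := eU _ iU; have := eX i; rewrite XC2; case: (i \in X); case: (i \in Y) => //=; lia.
  have := qU i; rewrite inE iU => /(_ isT); have := dX i; rewrite X2.
  case: (i \in X); case: (i \in Y) => //=; lia.
(* The same argument at B_i, whose extra point is a_{phi(i)}; here phi enters. *)
have hV i : (i \in V) = (i \notin Y) /\ (phi i \in X) = (i \notin Y).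
  case: (boolP (i \in V)) => iV.
    have := pV _ iV; rewrite inE; have := eY i; rewrite YC2.
    case: (i \in Y); case: (phi i \in X) => //=; lia.
  have := qV i; rewrite inE iV => /(_ isT); have := dY i; rewrite Y2.
  case: (i \in Y); case: (phi i \in X) => //=; lia.
split=> //.
- by apply/setP => i; rewrite inE (hU i).2.
- by apply/setP => i; rewrite inE (hU i).1.
- by apply/setP => i; rewrite (hV i).1 (hU i).2 negbK.
- by move=> i; rewrite (hV i).2 (hU i).2 negbK.
Qed.

Lemma special_simplex_of (D : {set simplex (point (moebius phi))}) :
  3 < n -> special_decomposition (phi := phi) D ->
  exists X, [/\ n = 4, #|X| = 2, (forall i, (phi i \in X) = (i \in X)) &
    D = [set simplex_of X (~: X) (~: X) X; simplex_of (~: X) X X (~: X)]].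
Proof.
move=> n_gt3 [/decompositionE[X [Y [U [V [-> [cP cB] _ [i12 i21]]]]]] nstd].
have [[XT UT]|[X0 U0]|[[n4 X2] -> -> -> phiX]] := inscribed_cases n_gt3 cP i12 i21.
(* In the two extreme cases the cardinalities determine Y and V, so the first simplex is standard,
   against [nstd]. *)
- have Y0 : Y = set0.
    by apply/eqP; rewrite -cards_eq0; move: cP; rewrite XT cardsT card_ord; lia.
  have V0 : V = set0.
    by apply/eqP; rewrite -cards_eq0; move: cB; rewrite UT cardsT card_ord; lia.
  by have [] := nstd _ (set21 _ _); rewrite std_simplexA_of XT UT Y0 V0.
- have YT : Y = setT.
    by apply/eqP; rewrite eqEcard subsetT; move: cP; rewrite X0 cards0 cardsT card_ord; lia.
  have VT : V = setT.
    by apply/eqP; rewrite eqEcard subsetT; move: cB; rewrite U0 cards0 cardsT card_ord; lia.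
  by have [_] := nstd _ (set21 _ _); rewrite std_simplexB_of X0 U0 YT VT.
- by exists X; rewrite setCK; split.
Qed.

End Simplices.

(** * Transport of decompositions along an isomorphism *)

Section Transport.
Variables (M N : configuration) (f : point M -> point N).
Hypotheses (bij_f : bijective f)
  (blocks_f : forall X : {set point M}, (X \in blocks M) = (f @: X \in blocks N)).

Let inj_f : injective f := bij_inj bij_f.
Let inj_fset : injective (fun k : {set point M} => f @: k) := imset_inj inj_f.

Lemma imset_bij_setT : f @: [set: point M] = [set: point N].
Proof.
have [g _ gK] := bij_f; apply/setP => x; rewrite inE.
by rewrite -(gK x) (mem_imset _ _ inj_f) inE.
Qed.

Lemma imset_blocks : [set f @: (k : {set _}) | k in blocks M] = blocks N.
Proof.
have [g gK fK] := bij_f; apply/setP => k.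
have -> : k = f @: (g @: k) by rewrite -imset_comp (eq_imset _ fK) imset_id.
by rewrite (mem_imset _ _ inj_fset) blocks_f.
Qed.

Lemma card_set_imset (aT rT : finType) (h : aT -> rT) (A : {set aT}) (p : pred rT) :
  injective h -> #|[set y in h @: A | p y]| = #|[set x in A | p (h x)]|.
Proof.
move=> inj_h; rewrite -(card_imset _ inj_h); congr #|pred_of_set _|.
apply/setP => y; rewrite inE; apply/andP/imsetP => [[/imsetP[x xA ->] px]|[x + ->]].
  by exists x; rewrite // inE xA.
by rewrite inE => /andP[xA px]; rewrite imset_f.
Qed.

Definition map_simplex (S : simplex (point M)) : simplex (point N) :=
  (f @: points_of S, [set f @: (k : {set _}) | k in blocks_of S]).

Lemma map_simplex_inj : injective map_simplex.
Proof.
by move=> [P K] [P' K'] [/(imset_inj inj_f) -> /(imset_inj inj_fset) ->].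
Qed.

Lemma simplicial_map S : simplicial S -> simplicial (map_simplex S).
Proof.
case=> hP hK; split=> _ /imsetP[x xS ->].
(* The [1] on the right is replaced by the count before mapping, so that two cardinals are
   compared. *)
- rewrite (card_set_imset _ (fun k : {set point N} => f x \notin k) inj_fset) -[RHS](hP x) //.
  by apply: eq_card => k; rewrite !inE (mem_imset _ _ inj_f).
- rewrite (card_set_imset _ (fun y => y \notin f @: x) inj_f) -[RHS](hK x) //.
  by apply: eq_card => y; rewrite !inE (mem_imset _ _ inj_f).
Qed.

Lemma inscribed_map S S' : inscribed S S' -> inscribed (map_simplex S) (map_simplex S').
Proof.
case=> hP hK; split=> _ /imsetP[x xS ->].
- rewrite (card_set_imset _ (fun k : {set point N} => f x \in k) inj_fset) -[RHS](hP x) //.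
  by apply: eq_card => k; rewrite !inE (mem_imset _ _ inj_f).
- rewrite (card_set_imset _ (fun y => y \in f @: x) inj_f) -[RHS](hK x) //.
  by apply: eq_card => y; rewrite !inE (mem_imset _ _ inj_f).
Qed.

Lemma complementary_map n S S' :
  complementary n S S' -> complementary n (map_simplex S) (map_simplex S').
Proof.
case=> [[UP dP cP cP'] [UK dK cK cK']]; split; split=> /=.
- by rewrite -imsetU UP imset_bij_setT.
- by rewrite imset_disjoint.
- by rewrite card_imset.
- by rewrite card_imset.
- by rewrite -imsetU UK imset_blocks.
- by rewrite imset_disjoint.
- by rewrite card_imset.
- by rewrite card_imset.
Qed.

Lemma decomposition_map n D :
  decomposition n D -> decomposition n (map_simplex @: D).
Proof.
case=> S [S' [-> cSS' [sS sS'] [iS iS']]].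
exists (map_simplex S), (map_simplex S'); split.
- by rewrite imsetU !imset_set1.
- exact: complementary_map.
- by split; apply: simplicial_map.
- by split; apply: inscribed_map.
Qed.

End Transport.

Lemma isomorphic_sym M N : isomorphic M N -> isomorphic N M.
Proof.
case=> f [g fK gK] fB; exists g; first by exists f.
by move=> X; rewrite fB -imset_comp (eq_imset _ gK) imset_id.
Qed.

(** * Special decompositions under isomorphism, and conjugate permutations *)

Section SpecialDecompositions.
Variables (n : nat) (phi : 'S_n).
Hypothesis n_gt2 : 2 < n.

Lemma simplex_of_compl X Y U V :
  simplex_of phi (~: X) (~: Y) (~: U) (~: V) =
  (~: points_of (simplex_of phi X Y U V),
   blocks (moebius phi) :\: blocks_of (simplex_of phi X Y U V)).
Proof. by rewrite /simplex_of -ptsetC -blsetC // blocks_blset. Qed.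

(** Each simplex of a decomposition is the complement of the other, and the standard simplices are
    complements of each other. So a single standard simplex in D already makes D the standard
    decomposition. *)
Lemma specialE (D : {set simplex (point (moebius phi))}) :
  special_decomposition (phi := phi) D <->
  decomposition n D /\ D <> [set std_simplexA phi; std_simplexB phi].
Proof.
have stdAC : std_simplexB phi =
    (~: (std_simplexA phi).1, blocks (moebius phi) :\: (std_simplexA phi).2).
  by rewrite std_simplexA_of std_simplexB_of -setCT -setC0 simplex_of_compl !setC0 !setCT.
have stdBC : std_simplexA phi =
    (~: (std_simplexB phi).1, blocks (moebius phi) :\: (std_simplexB phi).2).
  by rewrite std_simplexA_of std_simplexB_of -setCT -setC0 simplex_of_compl !setC0 !setCT.
split=> [[dD nD]|[dD nD]].
  by split=> // eD; have [] := nD (std_simplexA phi); rewrite // eD set21.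
split=> // S SD; have [X [Y [U [V [eD _ _ _]]]]] := (decompositionE n_gt2 D).1 dD.
have e1 := simplex_of_compl X Y U V.
have e2 := simplex_of_compl (~: X) (~: Y) (~: U) (~: V).
rewrite !setCK in e2; split=> eS; subst S; move: SD; rewrite eD => /set2P[] eS; apply: nD.
- by rewrite eD e1 -eS stdAC.
- by rewrite eD e2 -eS setUC stdAC.
- by rewrite eD e1 -eS setUC [in RHS]stdBC.
- by rewrite eD e2 -eS [in RHS]stdBC.
Qed.

End SpecialDecompositions.

Lemma special_isomorphic n (phi psi : 'S_n) : 2 < n ->
  isomorphic (moebius phi) (moebius psi) ->
  (exists D, special_decomposition (phi := phi) D) ->
  exists D, special_decomposition (phi := psi) D.
Proof.
move=> n_gt2 [f bij_f f_blocks] [D /(specialE n_gt2)[dD nD]].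
have dfD := decomposition_map bij_f f_blocks dD.
have dfS := decomposition_map bij_f f_blocks (std_decomposition phi n_gt2).
have [fD|fD] := eqVneq (map_simplex f @: D) [set std_simplexA psi; std_simplexB psi].
  exists (map_simplex f @: [set std_simplexA phi; std_simplexB phi]).
  (* The map on sets of simplices is injective: were the image of the standard decomposition
     standard too, D would be standard. *)
  apply/specialE => //; split=> // fS; apply: nD.
  by apply: (imset_inj (map_simplex_inj bij_f)); rewrite fD.
by exists (map_simplex f @: D); apply/specialE => //; split=> //; apply/eqP.
Qed.

(** Relabelling both point families by s sends A_i to A_{s(i)}, and B_i to B_{s(i)} because the
    conjugate maps s(i) to s(phi(i)). *)
Lemma isomorphic_conj n (phi s : 'S_n) :
  isomorphic (moebius phi) (moebius (phi ^ s)%g).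
Proof.
pose f (x : mpoint n) : mpoint n :=
  match x with inl i => pa (s i) | inr i => pb (s i) end.
have inj_f : injective f by move=> [i|i] [j|j] []// /perm_inj ->.
have fa (P : {set mpoint n}) i : (pa i \in f @: P) = (pa ((s^-1)%g i) \in P).
  by rewrite -[in LHS](permKV s i) (mem_imset P (pa _) inj_f : (f (pa _) \in f @: P) = _).
have fb (P : {set mpoint n}) i : (pb i \in f @: P) = (pb ((s^-1)%g i) \in P).
  by rewrite -[in LHS](permKV s i) (mem_imset P (pb _) inj_f).
have fA i : f @: blockA i = blockA (s i).
  by apply: eq_mpointset => j; rewrite ?fa ?fb !in_blockE (can2_eq (permKV s) (permK s)).
have fB i : f @: blockB phi i = blockB (phi ^ s)%g (s i).
  by apply: eq_mpointset => j;
    rewrite ?fa ?fb !in_blockE ?permJ (can2_eq (permKV s) (permK s)).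
exists f; first exact: injF_bij.
have fblocks : [set f @: (k : {set _}) | k in blocks (moebius phi)] =
    blocks (moebius (phi ^ s)%g).
  rewrite !blocks_blset; apply/setP => k; apply/imsetP/idP.
    by case=> _ /setUP[] /imsetP[i _ ->] ->; rewrite ?fA ?fB inE imset_f ?orbT.
  by case/setUP => /imsetP[i _ ->]; 
    [exists (blockA ((s^-1)%g i)) | exists (blockB phi ((s^-1)%g i))];
    rewrite ?fA ?fB ?permKV // inE imset_f ?orbT.
by move=> X; rewrite -fblocks (mem_imset _ _ (imset_inj inj_f)).
Qed.

(** * The number of fixed points as an isomorphism invariant *)

Section DisjointBlocks.
Variables (n : nat) (phi : 'S_n).
Hypothesis n_gt2 : 2 < n.

Definition perm_fix : {set 'I_n} := [set i | phi i == i].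

Definition has_disjoint (M : configuration) (k : {set point M}) : bool :=
  [exists l in blocks M, [disjoint k & l]].

(** As b_i lies on A_i, its absence from B_j means i = j; as a_{phi(j)} lies on B_j, its absence
    from A_i means phi(j) = i. *)
Lemma disjoint_blockAB i j :
  [disjoint blockA i & blockB phi j] = (i == j) && (phi i == i).
Proof.
rewrite -setI_eq0; apply/eqP/andP => [dij|[/eqP <- /eqP phi_i]].
  have := in_set0 (pb i); have := in_set0 (pa (phi j)).
  rewrite -dij !in_setI !in_blockE !eqxx andbT => /negbFE /eqP e1 /negbFE /eqP e2.
  by rewrite [in phi i]e2 e1 e2.
apply: eq_mpointset => k; rewrite in_setI in_set0 !in_blockE ?phi_i; first by case: eqP.
by case: eqP.
Qed.

Lemma disjoint_blockAA i j : [disjoint blockA i & @blockA n j] = false.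
Proof.
have [k] := exists_third n_gt2 i j; rewrite !inE negb_or => /andP[ki kj].
apply/negP => /disjointFr /(_ (_ : pa k \in _)); rewrite !in_blockE ki kj.
by move/(_ isT).
Qed.

Lemma disjoint_blockBB i j : [disjoint blockB phi i & blockB phi j] = false.
Proof.
have [k] := exists_third n_gt2 i j; rewrite !inE negb_or => /andP[ki kj].
apply/negP => /disjointFr /(_ (_ : pb k \in _)); rewrite !in_blockE ki kj.
by move/(_ isT).
Qed.

(** The left side refers to the configuration alone, so its cardinality is preserved by
    isomorphisms. *)
Lemma has_disjointE :
  [set k in blocks (moebius phi) | has_disjoint (M := moebius phi) k] =
  blset phi perm_fix perm_fix.
Proof.
apply: (eq_blset_sub (phi := phi)); rewrite ?blset_sub //.
- by rewrite -blocks_blset; apply/subsetP => k; rewrite inE => /andP[].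
- move=> i; rewrite in_set blocks_blset !mem_blset // !inE /=.
  apply/existsP/idP => [[l /andP[]]|phi_i].
    rewrite blocks_blset; move: l.
    apply: blset_elim => j _; rewrite ?disjoint_blockAA // disjoint_blockAB.
    by case/andP.
  exists (blockB phi i); rewrite blocks_blset mem_blset // inE.
  by rewrite disjoint_blockAB eqxx.
- move=> i; rewrite in_set blocks_blset !mem_blset // !inE /=.
  apply/existsP/idP => [[l /andP[]]|phi_i].
    rewrite blocks_blset; move: l.
    apply: blset_elim => j _; rewrite ?disjoint_blockBB // disjoint_sym disjoint_blockAB.
    by case/andP => /eqP ->.
  exists (blockA i); rewrite blocks_blset mem_blset // inE.
  by rewrite disjoint_sym disjoint_blockAB eqxx.
Qed.

End DisjointBlocks.

Lemma isomorphic_card_fix n (phi psi : 'S_n) : 2 < n ->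
  isomorphic (moebius phi) (moebius psi) -> #|perm_fix phi| = #|perm_fix psi|.
Proof.
(* Each fixed point i contributes the two blocks A_i and B_i, so the invariant is twice the number
   of fixed points. *)
move=> n_gt2 [f bij_f f_blocks]; apply: double_inj; rewrite -!addnn.
rewrite -(card_blset phi) // -(card_blset psi) // -!has_disjointE //.
rewrite -(imset_blocks bij_f f_blocks).
have inj_f := bij_inj bij_f.
rewrite (card_set_imset _ _ (imset_inj inj_f)).
apply: eq_card => k; rewrite !inE; congr (_ && _).
apply/existsP/existsP => -[l /andP[lB dkl]].
  by exists (f @: l); rewrite -f_blocks lB imset_disjoint.
move: lB dkl; rewrite -(imset_blocks bij_f f_blocks) => /imsetP[l' l'B ->].
by rewrite imset_disjoint // => dkl; exists l'; rewrite l'B.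
Qed.

(** * Special decompositions for n = 4 and invariant 2-subsets *)

Section Associated.
Variable phi : 'S_4.
Implicit Types X : {set 'I_4}.

Lemma assoc_simplexE X : assoc_simplex phi X = simplex_of phi X (~: X) (~: X) X.
Proof. by congr (_, _); apply: setUC. Qed.

Lemma assoc_decompositionE X :
  assoc_decomposition phi X =
  [set simplex_of phi X (~: X) (~: X) X; simplex_of phi (~: X) X X (~: X)].
Proof.
rewrite /assoc_decomposition /rest_simplex assoc_simplexE.
by rewrite -simplex_of_compl // !setCK.
Qed.

Lemma assoc_decompositionC X :
  assoc_decomposition phi (~: X) = assoc_decomposition phi X.
Proof. by rewrite !assoc_decompositionE setCK setUC. Qed.

Lemma simplex_of_inj X Y U V X' Y' U' V' :
  simplex_of phi X Y U V = simplex_of phi X' Y' U' V' -> X = X'.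
Proof.
by case=> /setP eP _; apply/setP => i; have := eP (pa i); rewrite !mem_ptset_pa.
Qed.

Lemma assoc_decomposition_eq X X' :
  assoc_decomposition phi X = assoc_decomposition phi X' -> X = X' \/ X = ~: X'.
Proof.
rewrite !assoc_decompositionE => eD.
have := set21 (simplex_of phi X (~: X) (~: X) X) (simplex_of phi (~: X) X X (~: X)).
by rewrite eD => /set2P[] /simplex_of_inj; [left | right].
Qed.

(** X and its complement are 2-sets preserved by phi, so every incidence count depends only on
    whether i lies in X. *)
Lemma assoc_decomposition_special X :
  #|X| = 2 -> (forall i, (phi i \in X) = (i \in X)) ->
  special_decomposition (phi := phi) (assoc_decomposition phi X).
Proof.
move=> X2 phiX; have phiVX i : ((phi^-1)%g i \in X) = (i \in X) by rewrite -phiX permKV.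
have XC2 : #|~: X| = 2 by have := cardsC X; rewrite X2 card_ord => -[].
have dX i : #|X :\ i| = 2 - (i \in X) by rewrite card_setD1 X2.
have dXC i : #|~: X :\ i| = 2 - (i \notin X) by rewrite card_setD1 XC2 inE.
rewrite assoc_decompositionE; apply/specialE => //; split.
  apply/decompositionE => //; exists X, (~: X), (~: X), X.
  rewrite !setCK X2 XC2; split=> //; split; apply/simplicialP || apply/inscribedP => //;
    by split=> i; rewrite ?inE ?X2 ?XC2 ?dX ?dXC ?phiX ?phiVX; case: (i \in X).
(* In the standard decomposition the sets of a-indices are I and the empty set, neither of size
   2. *)
rewrite std_simplexA_of std_simplexB_of => eD.
have := set21 (simplex_of phi X (~: X) (~: X) X) (simplex_of phi (~: X) X X (~: X)).
by rewrite eD => /set2P[] /simplex_of_inj eX; move: X2; rewrite eX ?cards0 // cardsT card_ord.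
Qed.

Lemma specialP (D : {set simplex (point (moebius phi))}) :
  special_decomposition (phi := phi) D <->
  exists X, [/\ #|X| = 2, (forall i, (phi i \in X) = (i \in X)) &
                D = assoc_decomposition phi X].
Proof.
split=> [/special_simplex_of[]// X [_ X2 phiX ->]|[X [X2 phiX ->]]].
  by exists X; rewrite assoc_decompositionE.
exact: assoc_decomposition_special.
Qed.

(** X and its complement give the same decomposition, so X may be chosen to contain [i0]; special
    decompositions are then listed by the partner j of [i0]. *)
Lemma special_containing i0 (D : {set simplex (point (moebius phi))}) :
  special_decomposition (phi := phi) D ->
  exists j, [/\ j != i0, phi i0 \in [set i0; j], phi j \in [set i0; j] &
                D = assoc_decomposition phi [set i0; j]].
Proof.
case/specialP => X [X2 phiX ->].
wlog i0X : X X2 phiX / i0 \in X => [IH|].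
  have [i0X|i0X] := boolP (i0 \in X); first exact: IH.
  rewrite -assoc_decompositionC; apply: IH; rewrite ?inE //.
    by have := cardsC X; rewrite X2 card_ord => -[].
  by move=> i; rewrite !inE phiX.
have /cards1P[j eXj] : #|X :\ i0| == 1.
  by rewrite card_setD1 X2 i0X.
have eX : X = [set i0; j] by rewrite -(setD1K i0X) eXj.
exists j; rewrite -eX !phiX i0X; split=> //; last by rewrite eX set22.
have : j \in X :\ i0 by rewrite eXj set11.
by rewrite !inE => /andP[].
Qed.

End Associated.

(** * Labels, and permutations of four elements with an invariant pair *)

Lemma lab_eq a b : 0 < a <= 4 -> 0 < b <= 4 -> (lab a == lab b) = (a == b).
Proof.
(* Both bounds matter: [lab 0] coincides with [lab 1], and a label above 4 falls to the default 0 of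
   [inord]. *)
by case: a b => [|a] [|b] //= a4 b4; rewrite -val_eqE /= !inordK.
Qed.

Lemma lab_cases (P : 'I_4 -> Prop) :
  P (lab 1) -> P (lab 2) -> P (lab 3) -> P (lab 4) -> forall i, P i.
Proof.
move=> P1 P2 P3 P4 i; have -> : i = lab i.+1 by rewrite /lab /= inord_val.
by case: i => -[|[|[|[|i]]]].
Qed.

(** Provides the conjugating permutations that carry the listed permutations to a given one. *)
Lemma perm_of_labels (p q r t : 'I_4) : uniq [:: p; q; r; t] ->
  exists s : 'S_4, [/\ s (lab 1) = p, s (lab 2) = q, s (lab 3) = r & s (lab 4) = t].
Proof.
move=> pqrt; pose g (i : 'I_4) := nth p [:: p; q; r; t] i.
have inj_g : injective g.
  by move=> i j /eqP; rewrite nth_uniq // => /eqP /val_inj.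
by exists (perm inj_g); split; rewrite permE /g inordK.
Qed.

Lemma invariant_pair_isomorphic (phi : 'S_4) (X : {set 'I_4}) :
  #|X| = 2 -> (forall i, (phi i \in X) = (i \in X)) ->
  [\/ isomorphic (moebius phi) (moebius phi_id),
      isomorphic (moebius phi) (moebius phi_13_24) |
      isomorphic (moebius phi) (moebius phi_12)].
Proof.
have conj_iso (psi s : 'S_4) : (psi ^ s)%g = phi -> isomorphic (moebius phi) (moebius psi).
  by move=> <-; apply/isomorphic_sym/isomorphic_conj.
have tperm_pair (Y : {set 'I_4}) p q : Y = [set p; q] -> p != q ->
    (forall i, (phi i \in Y) = (i \in Y)) ->
    (phi p = p /\ phi q = q) \/ (phi p = q /\ phi q = p).
  move=> -> pq phiY; have := phiY p; have := phiY q; rewrite !inE !eqxx orbT /=.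
  have phi_pq : phi p != phi q by rewrite (inj_eq perm_inj).
  move=> /orP[]/eqP eq_q /orP[]/eqP eq_p; move: phi_pq; rewrite eq_p eq_q ?eqxx //; auto.
move=> X2 phiX.
have XC2 : #|~: X| = 2 by have := cardsC X; rewrite X2 card_ord => -[].
have phiXC i : (phi i \in ~: X) = (i \in ~: X) by rewrite !inE phiX.
have /cards2P[p [q [pq eX]]] : #|X| == 2 by rewrite X2.
have /cards2P[r [t [rt eXC]]] : #|~: X| == 2 by rewrite XC2.
have disj x y : x \in X -> y \in ~: X -> x != y.
  by move=> xX; rewrite inE; apply: contraNneq => <-.
have pX : p \in X by rewrite eX set21.
have qX : q \in X by rewrite eX set22.
have rX : r \in ~: X by rewrite eXC set21.
have tX : t \in ~: X by rewrite eXC set22.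
have pqrt : uniq [:: p; q; r; t] by rewrite /= !inE !negb_or pq rt !disj.
have prqt : uniq [:: p; r; q; t].
  by rewrite /= !inE !negb_or (eq_sym r q) pq rt !disj.
have rtpq : uniq [:: r; t; p; q] by rewrite -(rot_uniq 2).
have perm4 (psi : 'S_4) : psi p = phi p -> psi q = phi q ->
    psi r = phi r -> psi t = phi t -> psi = phi.
  move=> ep eq er et; apply/permP => i; have [|] := boolP (i \in X).
    by rewrite eX => /set2P[] ->.
  by rewrite -in_setC eXC => /set2P[] ->.
have [pr pt] := (disj _ _ pX rX, disj _ _ pX tX).
have [qr qt] := (disj _ _ qX rX, disj _ _ qX tX).
have en x y : x != y -> y != x by rewrite eq_sym.
(* On each of X = {p, q} and its complement {r, t}, phi is the identity or the swap: no swap gives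
   the identity, one swap a conjugate of (12), two swaps a conjugate of (13)(24). *)
have [[ep eq]|[ep eq]] := tperm_pair X p q eX pq phiX;
  have [[er et]|[er et]] := tperm_pair (~: X) r t eXC rt phiXC.
- constructor 1; apply: (conj_iso _ 1%g); rewrite conj1g.
  by apply: perm4; rewrite perm1.
- have [s [s1 s2 _ _]] := perm_of_labels rtpq.
  constructor 3; apply: (conj_iso _ s); rewrite /phi_12 tpermJ s1 s2.
  by apply: perm4; rewrite ?tpermL ?tpermR ?ep ?eq ?er ?et // tpermD // en.
- have [s [s1 s2 _ _]] := perm_of_labels pqrt.
  constructor 3; apply: (conj_iso _ s); rewrite /phi_12 tpermJ s1 s2.
  by apply: perm4; rewrite ?tpermL ?tpermR ?ep ?eq ?er ?et // tpermD // en.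
(* The order p, r, q, t makes s carry the pairs {1,3} and {2,4} to {p,q} and {r,t}. *)
- have [s [s1 s2 s3 s4]] := perm_of_labels prqt.
  constructor 2; apply: (conj_iso _ s); rewrite /phi_13_24 conjMg !tpermJ s1 s2 s3 s4.
  apply: perm4; rewrite permM ?ep ?eq ?er ?et.
  + by rewrite tpermL tpermD // en.
  + by rewrite tpermR tpermD // en.
  + by rewrite (tpermD pr qr) tpermL.
  + by rewrite (tpermD pt qt) tpermR.
Qed.

(** The point sets have 2n and 2m elements. *)
Lemma isomorphic_eq_size n m (phi : 'S_n) (psi : 'S_m) :
  isomorphic (moebius phi) (moebius psi) -> n = m.
Proof.
case=> f /bij_eq_card + _; rewrite /= !card_sum !card_ord !addnn.
exact: double_inj.
Qed.

(** * The three listed permutations and the classification *)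

Lemma phi_12E : [/\ phi_12 (lab 1) = lab 2, phi_12 (lab 2) = lab 1,
  phi_12 (lab 3) = lab 3 & phi_12 (lab 4) = lab 4].
Proof. by rewrite /phi_12 tpermL tpermR !tpermD // lab_eq. Qed.

Lemma phi_13_24E : [/\ phi_13_24 (lab 1) = lab 3, phi_13_24 (lab 2) = lab 4,
  phi_13_24 (lab 3) = lab 1 & phi_13_24 (lab 4) = lab 2].
Proof.
split; rewrite permM.
- by rewrite tpermL tpermD // lab_eq.
- by rewrite (@tpermD _ (lab 1)) ?tpermL // lab_eq.
- by rewrite tpermR tpermD // lab_eq.
- by rewrite (@tpermD _ (lab 1)) ?tpermR // lab_eq.
Qed.

Lemma invariant_12 i :
  (phi_12 i \in [set lab 1; lab 2]) = (i \in [set lab 1; lab 2]).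
Proof.
have [e1 e2 e3 e4] := phi_12E.
by move: i; apply: lab_cases; rewrite ?e1 ?e2 ?e3 ?e4 !inE !lab_eq.
Qed.

Lemma invariant_13_24 i :
  (phi_13_24 i \in [set lab 1; lab 3]) = (i \in [set lab 1; lab 3]).
Proof.
have [e1 e2 e3 e4] := phi_13_24E.
by move: i; apply: lab_cases; rewrite ?e1 ?e2 ?e3 ?e4 !inE !lab_eq.
Qed.

Lemma card_lab2 a b : 0 < a <= 4 -> 0 < b <= 4 -> a != b -> #|[set lab a; lab b]| = 2.
Proof. by move=> a4 b4 ab; rewrite cards2 lab_eq // ab. Qed.

Lemma perm_fix_id : #|perm_fix phi_id| = 4.
Proof.
rewrite (_ : perm_fix _ = setT) ?cardsT ?card_ord //.
by apply/setP => i; rewrite !inE perm1 eqxx.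
Qed.

Lemma perm_fix_13_24 : #|perm_fix phi_13_24| = 0.
Proof.
have [e1 e2 e3 e4] := phi_13_24E.
rewrite (_ : perm_fix _ = set0) ?cards0 //; apply/setP.
by apply: lab_cases; rewrite !inE ?e1 ?e2 ?e3 ?e4 lab_eq.
Qed.

Lemma perm_fix_12 : #|perm_fix phi_12| = 2.
Proof.
have [e1 e2 e3 e4] := phi_12E.
rewrite (_ : perm_fix _ = [set lab 3; lab 4]) ?card_lab2 //; apply/setP.
by apply: lab_cases; rewrite !inE ?e1 ?e2 ?e3 ?e4 !lab_eq.
Qed.

(** Equal decompositions come from equal or complementary pairs; two pairs that share the label 1
    are not complementary. *)
Lemma assoc_decomposition_1_neq (phi : 'S_4) a b :
  1 < a <= 4 -> 1 < b <= 4 -> a != b ->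
  assoc_decomposition phi [set lab 1; lab a] <> assoc_decomposition phi [set lab 1; lab b].
Proof.
move=> /andP[a1 a4] /andP[b1 b4] ab /assoc_decomposition_eq[] /setP.
  move/(_ (lab a)); rewrite !inE !lab_eq ?(ltnW a1) ?(ltnW b1) //.
  by rewrite eqxx orbT (negPf ab) orbF eqn_leq [a <= 1]leqNgt a1.
by move/(_ (lab 1)); rewrite !inE eqxx.
Qed.

Theorem corollary2p4 :
  (* classification *)
  (forall (n : nat) (phi : 'S_n), 4 <= n ->
     ((exists D, special_decomposition (phi := phi) D)
      <-> [\/ isomorphic (moebius phi) (moebius phi_id),
              isomorphic (moebius phi) (moebius phi_13_24) |
              isomorphic (moebius phi) (moebius phi_12)]))
  (* the three pairs are distinct up to isomorphism *)
  /\ [/\ ~ isomorphic (moebius phi_id) (moebius phi_13_24),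
         ~ isomorphic (moebius phi_id) (moebius phi_12) &
         ~ isomorphic (moebius phi_13_24) (moebius phi_12)]
  (* 1. *)
  /\ ((forall D, special_decomposition (phi := phi_id) D
         <-> [\/ D = assoc_decomposition phi_id [set lab 1; lab 2],
                 D = assoc_decomposition phi_id [set lab 1; lab 3] |
                 D = assoc_decomposition phi_id [set lab 1; lab 4]])
      /\ [/\ assoc_decomposition phi_id [set lab 1; lab 2]
               <> assoc_decomposition phi_id [set lab 1; lab 3],
             assoc_decomposition phi_id [set lab 1; lab 2]
               <> assoc_decomposition phi_id [set lab 1; lab 4] &
             assoc_decomposition phi_id [set lab 1; lab 3]
               <> assoc_decomposition phi_id [set lab 1; lab 4]])
  (* 2. *)
  /\ (forall D, special_decomposition (phi := phi_13_24) D
        <-> D = assoc_decomposition phi_13_24 [set lab 1; lab 3])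
  (* 3. *)
  /\ (forall D, special_decomposition (phi := phi_12) D
        <-> D = assoc_decomposition phi_12 [set lab 1; lab 2]).
Proof.
have sp_id a : 1 < a <= 4 ->
    special_decomposition (phi := phi_id) (assoc_decomposition phi_id [set lab 1; lab a]).
  move=> /andP[a1 a4]; apply: assoc_decomposition_special => [|i]; last by rewrite perm1.
  by rewrite card_lab2 // ?(ltnW a1) // neq_ltn a1.
have sp_13_24 : special_decomposition (phi := phi_13_24)
    (assoc_decomposition phi_13_24 [set lab 1; lab 3]).
  by apply: assoc_decomposition_special invariant_13_24; rewrite card_lab2.
have sp_12 : special_decomposition (phi := phi_12)
    (assoc_decomposition phi_12 [set lab 1; lab 2]).
  by apply: assoc_decomposition_special invariant_12; rewrite card_lab2.
split.
  move=> n phi n_ge4; split=> [[D spD]|].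
    have [_ [n4 _ _ _]] := special_simplex_of (ltnW n_ge4) n_ge4 spD; subst n.
    have [X [X2 phiX _]] := (specialP D).1 spD.
    exact: invariant_pair_isomorphic X2 phiX.
  (* The listed pairs have n = 4, and the existence of a special decomposition passes back along the
     inverse isomorphism. *)
  by case=> iso; move: (isomorphic_eq_size iso) => n4; subst n;
     apply: (special_isomorphic _ (isomorphic_sym iso)) => //; eexists;
     [exact: (sp_id 2) | exact: sp_13_24 | exact: sp_12].
split.
  (* The numbers of fixed points are 4, 0 and 2. *)
  by split=> /(isomorphic_card_fix (n := 4) isT);
     rewrite ?perm_fix_id ?perm_fix_12 ?perm_fix_13_24.
split; first split.
- move=> D; split=> [|[] ->]; [|exact: (sp_id 2)|exact: (sp_id 3)|exact: (sp_id 4)].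
  (* The pair is chosen to contain the label 1, so only its partner j, one of 2, 3, 4, remains to be
     named. *)
  case/(special_containing (lab 1)) => j [+ _ _ ->]; move: j; apply: lab_cases.
  + by rewrite eqxx.
  + by constructor 1.
  + by constructor 2.
  + by constructor 3.
- by split; apply: assoc_decomposition_1_neq.
split=> D; (split; last by move=> ->).
(* Here phi(1) differs from 1 and lies in the invariant pair {1, j}, which forces j = phi(1); the
   last case is alike. *)
- case/(special_containing (lab 1)) => j [j1 + _ ->].
  have [-> _ _ _] := phi_13_24E.
  by rewrite !inE lab_eq //= => /eqP ->.
- case/(special_containing (lab 1)) => j [j1 + _ ->].
  have [-> _ _ _] := phi_12E.
  by rewrite !inE lab_eq //= => /eqP ->.
Qed.
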